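(* Let $X$ and $Y$ be Banach spaces and assume that there is a weakly sequentially continuous map $f:X\to Y$ which is coarse and satisfies Property $( * )$. Let $p\in[1,\infty)$. If $Y$ is $p$-asymptotically uniformly convex, then $X$ has the $p$-co-Banach-Saks property.
   Context: Maps. For a map $f:X\to Y$ between Banach spaces (not assumed linear) let $\omega_f(t)=\sup\{\|f(x)-f(y)\| : \|x-y\|\le t\}$ for $t\ge 0$. The map $f$ is coarse if $\omega_f(t)<\infty$ for all $t\ge 0$. It satisfies Property $( * )$ if there exist $\beta>\alpha>0$ such that $\inf_{\|x-y\|\in[\alpha,\beta]}\|f(x)-f(y)\|>0$. It is weakly sequentially continuous if $x_n\to x$ weakly in $X$ implies $f(x_n)\to f(x)$ weakly in $Y$. Asymptotic uniform convexity. For a Banach space $Y$ and $t\ge 0$, \[\overline{\delta}_Y(t)=\inf_{x\in\partial B_Y}\ \sup_{E\in\mathrm{cof}(Y)}\ \inf_{y\in\partial B_E}\|x+ty\|-1,\] where $\partial B$ denotes the unit sphere and $\mathrm{cof}(Y)$ is the set of closed finite-codimensional subspaces of $Y$. $Y$ is $p$-asymptotically uniformly convex ($p$-AUC) if there is $K>0$ with $\overline{\delta}_Y(t)\ge Kt^p$ for all $t\in[0,1]$. Spreading models. Let $(x_n)_n$ be a bounded sequence without Cauchy subsequences in a Banach space $(X,\|\cdot\|)$. A sequence $(e_n)_n$ in a Banach space $(S,\|\cdot\|_S)$ is the spreading model of $(x_n)_n$ if for all $\varepsilon>0$ and $k\in\mathbb{N}$ there is $\ell\in\mathbb{N}$ such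 that $\big|\,\|\sum_{i=1}^k a_ix_{n_i}\|-\|\sum_{i=1}^k a_ie_i\|_S\,\big|\le\varepsilon$ for all $\ell\le n_1<\ldots<n_k$ and all $a_1,\ldots,a_k\in[-1,1]$. $X$ has the $p$-co-Banach-Saks property if there is $C>0$ such that every spreading model $(e_n)_n$ in a Banach space $(S,\|\cdot\|_S)$ of a normalized weakly null sequence in $X$ satisfies $\|e_1+\ldots+e_k\|_S\ge Ck^{1/p}$ for all $k\in\mathbb{N}$. *)

(* Defs.v *)
From mathcomp Require Import all_boot all_order all_algebra.
From mathcomp Require Import all_classical all_reals all_analysis.

Set Implicit Arguments.
Unset Strict Implicit.
Unset Printing Implicit Defensive.

Import Order.TTheory GRing.Theory Num.Theory.
Import numFieldNormedType.Exports.

Local Open Scope classical_set_scope.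
Local Open Scope ring_scope.

(* Banach spaces are real: [completeNormedModType R] with [R : realType].
   Infima and suprema are taken in [\bar R], so that the infimum of the empty set is +oo and the
   moduli below make sense without finiteness assumptions. *)

Definition unit_sphere (R : realType) (V : normedModType R) : set V :=
  [set x | `|x| = 1].

(* The topological dual consists of the continuous linear maps to [R^o], i.e.
   [R] seen as a normed space over itself. *)
Definition weak_cvg (R : realType) (V : normedModType R)
    (u : nat -> V) (l : V) : Prop :=
  forall phi : {linear V -> R^o}, continuous phi ->
    (fun n => phi (u n)) @ \oo --> phi l.

Section maps.
Variables (R : realType) (V W : normedModType R).
Implicit Type f : V -> W.

Definition expansion_modulus f (t : R) : \bar R :=
  ereal_sup [set `|f z.1 - f z.2|%:E | z in [set z : V * V | `|z.1 - z.2| <= t]].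

Definition coarse f : Prop :=
  forall t : R, 0 <= t -> (expansion_modulus f t < +oo)%E.

Definition property_star f : Prop :=
  exists alpha beta : R, [/\ 0 < alpha, alpha < beta &
    (0%:E < ereal_inf [set (`|f z.1 - f z.2|%R)%:E | z in
       [set z : V * V | (alpha <= `|z.1 - z.2| <= beta)%R]])%E].

Definition weakly_seq_continuous f : Prop :=
  forall (u : nat -> V) (l : V), weak_cvg u l -> weak_cvg (f \o u) (f l).

End maps.

Section asymptotic_uniform_convexity.
Variables (R : realType) (V : normedModType R).

(* [dim (V / E)] is finite: finitely many vectors span [V] modulo [E] *)
Definition finite_codim (E : set V) : Prop :=
  exists (n : nat) (v : 'I_n -> V), forall x : V,
    exists a : 'I_n -> R, E (x - \sum_(i < n) a i *: v i).

Definition cof : set (set V) :=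
  [set E | [/\ submod_closed (mem E), closed E & finite_codim E]].

Definition auc_modulus (t : R) : \bar R :=
  (ereal_inf [set ereal_sup [set ereal_inf [set (`|x + t *: y|%R)%:E |
                                            y in E `&` @unit_sphere R V] |
                             E in cof] |
              x in @unit_sphere R V] - 1)%E.

Definition p_AUC (p : R) : Prop :=
  exists2 K : R, 0 < K &
    forall t : R, 0 <= t <= 1 -> ((K * t `^ p)%:E <= auc_modulus t)%E.

End asymptotic_uniform_convexity.

(* Sequences are indexed from 0: the first [k] terms of [e] are
   [e 0, ..., e k.-1]. *)
Definition spreading_model (R : realType) (V S : normedModType R)
    (x : nat -> V) (e : nat -> S) : Prop :=
  [/\ bounded_fun x,
      (forall s : nat -> nat, increasing_seq s -> ~ cauchy ((x \o s) @ \oo)) &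
      forall (eps : R) (k : nat), 0 < eps ->
        exists l : nat, forall (n : 'I_k -> nat) (a : 'I_k -> R),
          (forall i, (l <= n i)%N) ->
          (forall i j : 'I_k, (i < j)%N -> (n i < n j)%N) ->
          (forall i, -1 <= a i <= 1) ->
          `| `|\sum_(i < k) a i *: x (n i)| - `|\sum_(i < k) a i *: e i| |
             <= eps].

Definition co_Banach_Saks (R : realType) (V : normedModType R) (p : R) : Prop :=
  exists2 C : R, 0 < C &
    forall (S : completeNormedModType R) (x : nat -> V) (e : nat -> S),
      (forall n, `|x n| = 1) -> weak_cvg x 0 -> spreading_model x e ->
      forall k : nat, C * k%:R `^ p^-1 <= `|\sum_(i < k) e i|.

(* Main.v *)
(* Let x be normalized and weakly null, and let f separate points at distance
   [alpha] by at least [th].  By weak sequential continuity,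
   f (s + alpha x_n) - f s is weakly null in n, with norm at least [th], so
   adding the terms alpha x_n one at a time, each far enough along the
   sequence, p-AUC makes the p-th power of |f (alpha (x_{n_1} + ... + x_{n_N})) - f 0|
   grow by at least a constant at every step.  On the other hand coarse maps
   are Lipschitz at large distances, so this norm is at most affine in
   |x_{n_1} + ... + x_{n_N}|.  Taking N = m k and cutting the sum into m blocks
   of length k, each of norm close to |e_1 + ... + e_k|, a fixed large m absorbs
   the additive constant of the affine bound, for every k >= 1. *)
From HB Require Import structures.
Require Import Defs.
From mathcomp Require Import all_boot all_order all_algebra.
From mathcomp Require Import all_classical all_reals all_analysis.
From mathcomp Require Import lra.

Import Order.TTheory GRing.Theory Num.Theory.
Import numFieldNormedType.Exports.

Local Open Scope classical_set_scope.
Local Open Scope ring_scope.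

(** * Closed subspaces of finite codimension and weakly null sequences *)

Section closed_subspaces.
Set Implicit Arguments.
Unset Strict Implicit.
Variables (R : realType) (V : normedModType R).
Implicit Type E : set V.

Lemma submod_closedP E : submod_closed (mem E) <->
  E 0 /\ forall (a : R) x y, E x -> E y -> E (a *: x + y).
Proof.
split=> -[E0 EL]; split.
- exact: set_mem.
- by move=> a x y /mem_set Ex /mem_set Ey; apply/set_mem/EL.
- exact: mem_set.
- by move=> a x y /set_mem Ex /set_mem Ey; apply/mem_set/EL.
Qed.

Definition add_line E (v : V) : set V := [set x | exists s : R, E (x - s *: v)].

Lemma add_line_submod E v :
  submod_closed (mem E) -> submod_closed (mem (add_line E v)).
Proof.
move=> /submod_closedP[E0 EL]; apply/submod_closedP; split.
  by exists 0; rewrite scale0r subr0.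
move=> a x y [s Es] [t Et]; exists (a * s + t).
rewrite scalerDl -scalerA opprD addrACA -scalerBr.
exact: EL.
Qed.

(** Some ball of radius [d] about [v] misses [E], and [- s^-1 *: e] would lie in it if the bound
    failed. Hence the coefficient of [v] is controlled by the norm. *)
Lemma add_line_norm_ge E v : submod_closed (mem E) -> closed E -> ~ E v ->
  exists2 d : R, 0 < d & forall e (s : R), E e -> d * `|s| <= `|e + s *: v|.
Proof.
move=> /submod_closedP[E0 EL] Ecl nEv.
have : nbhs v (~` E) by apply: open_nbhs_nbhs; split => //; exact: closed_openC.
move=> /nbhs_ballP[d /= d0 dE]; exists d => // e s Ee.
have [->|s0] := eqVneq s 0; first by rewrite normr0 mulr0.
rewrite leNgt; apply/negP => lt_d.
apply: (dE (- s^-1 *: e)); last by rewrite -[_ *: e]addr0; apply: EL.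
rewrite -ball_normE /ball_/=.
have -> : v - (- s^-1 *: e) = s^-1 *: (e + s *: v).
  by rewrite scalerDr scalerA mulVf// scale1r scaleNr opprK addrC.
by rewrite normrZ normfV mulrC ltr_pdivrMr ?normr_gt0.
Qed.

(** The coefficient of [v] is Lipschitz on [add_line E v], so along a convergent filter it is Cauchy
    with some limit [l]; then [x - l *: v] is a limit of points of [E]. *)
Lemma add_line_closed E v :
  submod_closed (mem E) -> closed E -> ~ E v -> closed (add_line E v).
Proof.
move=> Esub Ecl nEv.
have [d d0 dE] := add_line_norm_ge Esub Ecl nEv.
have [E0 EL] := (submod_closedP _).1 Esub.
have /choice[s sE] : forall x, exists s : R, add_line E v x -> E (x - s *: v).
  move=> x; have [[s Es]|nx] := pselect (add_line E v x); first by exists s.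
  by exists 0.
move=> x; rewrite closureEcvg => -[F FF [Fx FE]].
have s_lip y z : add_line E v y -> add_line E v z ->
    d * `|s y - s z| <= `|y - z|.
  move=> /sE Ey /sE Ez.
  have -> : y - z = ((y - s y *: v) - (z - s z *: v)) + (s y - s z) *: v.
    by rewrite scalerBl addrACA subrK -opprD subrK.
  by apply: dE; rewrite addrC -scaleN1r; apply: EL.
have FvE : F (add_line E v) by apply: FE.
have /cauchy_cvgP/cvg_ex[l sl] : cauchy (s @ F).
  apply: cauchy_exP => eps eps0.
  have FB : F (ball x (d * eps / 2)) by apply: Fx; apply: nbhsx_ballx; nra.
  have [y [yB yE]] := filter_ex (filterI FB FvE).
  exists (s y).
  change (F (s @^-1` ball (s y) eps)); near=> z.
  have zE : add_line E v z by near: z.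
  have zB : ball x (d * eps / 2) z by near: z.
  have yz : `|y - z| < d * eps.
    move: yB zB; rewrite -ball_normE /ball_/= => yB zB.
    rewrite [X in _ < X]splitr (le_lt_trans (ler_distD x _ _))//.
    by rewrite ltrD// distrC.
  have := le_lt_trans (s_lip _ _ yE zE) yz.
  by rewrite ltr_pM2l// -ball_normE.
exists l.
apply: (@closed_cvg _ _ F _ (fun y => y - s y *: v) E) => //.
  by near=> z; apply: sE; near: z.
by apply: cvgB => //; apply: cvgZr_tmp.
Unshelve. all: by end_near. Qed.

Lemma linear_bound_continuous (W : normedModType R) (g : {linear V -> W})
    (C : R) : (forall x, `|g x| <= C * `|x|) -> continuous g.
Proof.
move=> gC; apply: bounded_linear_continuous; apply/linear_boundedP.
near=> r => x; apply: (le_trans (gC x)).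
by rewrite ler_wpM2r.
Unshelve. all: by end_near. Qed.

(* The remainder [y - P y] takes its values in a finite-dimensional complement
   of [E] and depends on [y] through finitely many continuous functionals. *)
Lemma finite_codim_projection n E : submod_closed (mem E) -> closed E ->
  (exists v : 'I_n -> V, forall x, exists a : 'I_n -> R,
     E (x - \sum_(i < n) a i *: v i)) ->
  exists (P : {linear V -> V}) (C : R),
    [/\ forall x, E (P x), forall x, `|P x| <= C * `|x| &
        forall y : nat -> V, weak_cvg y 0 ->
          (fun m => y m - P (y m)) @ \oo --> 0].
Proof.
elim: n E => [|n IH] E Esub Ecl [v vE].
  exists idfun, 1; split=> [x|x|y _]; first 2 last.
  - under eq_fun do rewrite subrr; exact: cvg_cst.
  - by have [a] := vE x; rewrite big_ord0 subr0.
  - by rewrite mul1r.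
pose w := v ord_max; pose v' i := v (widen_ord (leqnSn n) i).
have v'E : forall x, exists a : 'I_n -> R,
    add_line E w (x - \sum_(i < n) a i *: v' i).
  move=> x; have [a Ea] := vE x.
  exists (fun i => a (widen_ord (leqnSn n) i)), (a ord_max).
  by move: Ea; rewrite big_ord_recr/= opprD addrA.
have [Ew|nEw] := pselect (E w).
  apply: IH => //; exists v' => x; have [a [s Es]] := v'E x.
  exists a; have [_ EL] := (submod_closedP _).1 Esub.
  by rewrite -[X in E X](subrK (s *: w)) addrC; apply: EL.
(* The induction hypothesis is applied to [add_line E w]. Subtracting from [P x] its component along
   [w], whose coefficient [s] is a bounded linear functional, lands in [E]. *)
have [P [C [PE PC Pw]]] :=
  IH _ (add_line_submod w Esub) (add_line_closed Esub Ecl nEw)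
     (ex_intro _ v' v'E).
have [d d0 dE] := add_line_norm_ge Esub Ecl nEw.
have [E0 EL] := (submod_closedP _).1 Esub.
have /choice[s sE] := PE.
have s_uniq x t : E (P x - t *: w) -> s x = t.
  move=> Et; apply/eqP; rewrite -subr_eq0 -normr_le0 -(pmulr_rle0 _ d0).
  have Est : E ((-1) *: (P x - t *: w) + (P x - s x *: w)) by exact: EL.
  apply: le_trans (dE _ _ Est) _.
  rewrite scaleN1r addrC scalerBl addrC [X in X + _]addrC.
  by rewrite addrACA subrK -opprD subrK subrr normr0.
have s_lin : linear (s : V -> R^o).
  move=> a x y; apply: s_uniq; rewrite linearP scalerDl -scalerA.
  by rewrite opprD addrACA -scalerBr; apply: EL.
pose sL := GRing.isLinear.Build R V R^o *:%R s s_lin.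
pose sf : {linear V -> R^o} := HB.pack s sL.
have s_bd x : `|sf x| <= d^-1 * C * `|x|.
  rewrite -mulrA ler_pdivlMl//; apply: le_trans (PC x).
  by rewrite -[X in _ <= `|X|](subrK (s x *: w)); exact: dE.
have Q_lin : linear (fun x => P x - s x *: w).
  move=> a x y; rewrite s_lin linearP scalerDl -scalerA.
  by rewrite opprD addrACA -scalerBr.
pose QL := GRing.isLinear.Build R V V *:%R _ Q_lin.
pose Q : {linear V -> V} := HB.pack (fun x => P x - s x *: w) QL.
exists Q, (C + d^-1 * C * `|w|); split=> [x|x|y y0] /=; first exact: sE.
  apply: (le_trans (ler_normB _ _)); rewrite mulrDl lerD//.
  by rewrite normrZ mulrAC ler_wpM2r//; exact: s_bd.
have sy0 : (s \o y) @ \oo --> (0 : R).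
  by have := y0 sf (linear_bound_continuous s_bd); rewrite linear0.
have lim0 : 0 = 0 + 0 *: w :> V by rewrite scale0r addr0.
rewrite [X in _ --> X]lim0.
under eq_fun do rewrite opprB addrCA addrC.
exact: cvgD (Pw y y0) (@cvgZr_tmp _ V _ _ _ (s \o y) 0 w sy0).
Qed.

Lemma weakly_null_dist_cof E (y : nat -> V) (eps : R) :
  cof E -> weak_cvg y 0 -> 0 < eps ->
  \forall n \near \oo, exists2 z, E z & `|y n - z| < eps.
Proof.
move=> [Esub Ecl [n Ev]] y0 eps0.
have [P [C [PE _ Py]]] := finite_codim_projection Esub Ecl Ev.
have /cvgrPdist_lt/(_ _ eps0) := Py _ y0.
by apply: filterS => m; rewrite sub0r normrN; exists (P (y m)).
Qed.

End closed_subspaces.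

(** * Norm growth along weakly null perturbations *)

Section asymptotic_lower_estimate.
Set Implicit Arguments.
Unset Strict Implicit.
Variables (R : realType) (Y : normedModType R) (p K : R).
Hypotheses (p1 : 1 <= p) (K0 : 0 < K).
Hypothesis auc : forall t : R, 0 <= t <= 1 ->
  ((K * t `^ p)%:E <= auc_modulus Y t)%E.

(** The supremum over subspaces need not be attained; the strict inequality on [c] lets a single [E]
    exceed it. *)
Lemma auc_cof (x : Y) (t c : R) : `|x| = 1 -> 0 <= t <= 1 -> c < K * t `^ p ->
  exists2 E : set Y, cof E &
    forall y, E y -> `|y| = 1 -> 1 + c <= `|x + t *: y|.
Proof.
move=> x1 /auc; rewrite /auc_modulus leeBrDr// => h ct.
have := le_trans h (ereal_inf_lbound (imageP _ x1)).
set S := ereal_sup _ => hS.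
have : ((1 + c)%:E < S)%E.
  by apply: lt_le_trans hS; rewrite -EFinD lte_fin addrC ltrD2r.
move=> /ereal_sup_gt[_ [E Ecof <-]] lt_inf; exists E => // y Ey y1.
rewrite -lee_fin; apply: le_trans (ltW lt_inf) _.
by apply: ereal_inf_lbound; exists y.
Qed.

(* Rescaling [y n] to norm exactly [th] stays, by convexity of the norm, below
   the original estimate, and lets a single [E] serve all [n]. *)
Lemma auc_weakly_null (x : Y) (y : nat -> Y) (th : R) :
  0 < th -> th <= `|x| -> (forall n, th <= `|y n|) -> weak_cvg y 0 ->
  \forall n \near \oo, `|x| * (1 + K / 2 * (th / `|x|) `^ p) <= `|x + y n|.
Proof.
move=> th0; set r := `|x| => thr thy y0.
have r0 : 0 < r by exact: lt_le_trans thr.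
set t := th / r; set q := t `^ p.
have t0 : 0 < t by rewrite divr_gt0.
have t1 : t <= 1 by rewrite ler_pdivrMr// mul1r.
have q0 : 0 < q by rewrite powR_gt0.
have Kq0 : 0 < K * q by rewrite mulr_gt0.
(* Of the factor 3/4, one quarter pays for the approximation errors below, leaving the 1/2 of the
   statement. *)
have [E Ecof Et] : exists2 E : set Y, cof E &
    forall y, E y -> `|y| = 1 -> 1 + 3 / 4 * (K * q) <= `|r^-1 *: x + t *: y|.
  apply: auc_cof; last 2 first.
  - by rewrite (ltW t0) t1.
  - by rewrite -/q; lra.
  - by rewrite normrZ normfV normr_id mulVf// gt_eqF.
(* The first bound keeps [s *: z] nonzero; the second makes the total error [eps + eps] at most a
   quarter of [r * (K * q)]. *)
pose eps := Num.min (th / 2) (r * (K * q) / 8).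
have eps0 : 0 < eps by rewrite lt_min !divr_gt0// mulr_gt0.
have eps1 : eps <= th / 2 by rewrite ge_min lexx.
have eps2 : eps <= r * (K * q) / 8 by rewrite ge_min lexx orbT.
have := weakly_null_dist_cof Ecof y0 eps0; apply: filterS => n [z Ez yz].
have yn0 : 0 < `|y n| by exact: lt_le_trans (thy n).
pose s := th / `|y n|.
have s0 : 0 < s by rewrite divr_gt0.
have s1 : s <= 1 by rewrite ler_pdivrMr// mul1r.
have sy : `|s *: y n| = th.
  by rewrite normrZ (gtr0_norm s0) divfK// gt_eqF.
have syz : `|s *: y n - s *: z| <= eps.
  rewrite -scalerBr normrZ (gtr0_norm s0).
  by apply: le_trans (ltW yz); rewrite ler_piMl.
have := ler_dist_dist (s *: y n) (s *: z); rewrite sy => thz.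
have {}thz := le_trans thz syz.
have z0 : 0 < `|s *: z| by move: thz; rewrite ler_norml; lra.
pose u := `|s *: z|^-1 *: (s *: z).
have u1 : `|u| = 1 by rewrite normrZ normfV normr_id mulVf// gt_eqF.
have Eu : E u.
  have [/submod_closedP[E0 EL] _ _] := Ecof.
  by rewrite /u scalerA -[_ *: z]addr0; apply: EL.
(* One [eps] is the distance to [s *: z], the other the cost of rescaling it to norm [th]. *)
have syu : `|s *: y n - th *: u| <= eps + eps.
  apply: le_trans (ler_distD (s *: z) _ _) _; rewrite lerD//.
  rewrite -[X in X - _](scale1r (s *: z)) -(divff (lt0r_neq0 z0)) -scalerA -/u.
  by rewrite -scalerBl normrZ u1 mulr1 distrC.
clearbody u s.
have xu : r * (1 + 3 / 4 * (K * q)) <= `|x + th *: u|.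
  have -> : x + th *: u = r *: (r^-1 *: x + t *: u).
    rewrite scalerDr !scalerA.
    rewrite divff ?gt_eqF// scale1r /t mulrCA divff ?gt_eqF//.
    by rewrite mulr1.
  by rewrite normrZ gtr0_norm// ler_pM2l//; exact: Et.
have xw : `|x + th *: u| <= `|x + s *: y n| + (eps + eps).
  have -> : x + th *: u = (x + s *: y n) - (s *: y n - th *: u).
    by rewrite opprB addrA addrAC addrK.
  exact: le_trans (ler_normB _ _) (lerD (lexx _) syu).
have xc : `|x + s *: y n| <= (1 - s) * r + s * `|x + y n|.
  have -> : x + s *: y n = (1 - s) *: x + s *: (x + y n).
    by rewrite scalerBl scale1r scalerDr addrA subrK.
  apply: le_trans (ler_normD _ _) _; rewrite !normrZ (gtr0_norm s0).
  by rewrite ger0_norm// subr_ge0.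
have rKq0 : 0 < r * (K * q) by exact: mulr_gt0.
set B := r * _; set N := `|x + y n| in xc *.
have rB : r <= B by rewrite /B; lra.
have Bw : B <= `|x + s *: y n| by rewrite /B; lra.
(* If [N < B], the convex combination in [xc] of [r <= B] and [N] is below [B], against [Bw]. *)
rewrite leNgt; apply/negP => NB.
have : (1 - s) * r <= (1 - s) * B by rewrite ler_wpM2l ?subr_ge0.
have : s * N < s * B by rewrite ltr_pM2l.
lra.
Qed.

(** Taking powers cancels the norm of [x] from the gain, since [1 + u] is at most its [p]-th power.
    The gain is thus the same at every step and can be summed. *)
Lemma auc_weakly_null_powR (x : Y) (y : nat -> Y) (th : R) :
  0 < th -> th <= `|x| -> (forall n, th <= `|y n|) -> weak_cvg y 0 ->
  \forall n \near \oo, `|x| <= `|x + y n| /\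
    `|x| `^ p + K / 2 * th `^ p <= `|x + y n| `^ p.
Proof.
move=> th0 thx thy y0; have r0 : 0 < `|x| by exact: lt_le_trans thx.
have := auc_weakly_null th0 thx thy y0; apply: filterS => n.
set u := K / 2 * _ => xy.
have u0 : 0 <= u by apply: mulr_ge0 (powR_ge0 _ _); rewrite divr_ge0// ltW.
split; first by apply: le_trans xy; rewrite ler_pMr//; lra.
have -> : K / 2 * th `^ p = `|x| `^ p * u.
  rewrite /u mulrCA -powRM ?divr_ge0 ?ltW// mulrCA divff ?gt_eqF// mulr1//.
rewrite -[X in X + _]mulr1 -mulrDr.
have : `|x| `^ p * (1 + u) `^ p <= `|x + y n| `^ p.
  have u1 : 0 <= 1 + u by exact: addr_ge0.
  by rewrite -powRM// ge0_ler_powR ?nnegrE ?mulr_ge0 ?(le_trans ler01 p1).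
apply: le_trans; rewrite ler_wpM2l ?powR_ge0//.
rewrite -[X in X <= _]powRr1 ?addr_ge0//.
by apply: ler_powR; rewrite ?lerDl.
Qed.

End asymptotic_lower_estimate.

(** * Inductive choice of a subsequence with large image sums *)

Section lower_bound_on_sums.
Set Implicit Arguments.
Unset Strict Implicit.
Variable R : realType.

Lemma weak_cvg_affine (V : normedModType R) (x : nat -> V) (s : V) (a : R) :
  weak_cvg x 0 -> weak_cvg (fun n => s + a *: x n) s.
Proof.
move=> x0 phi phic; have := x0 phi phic; rewrite linear0 => px.
have lim_s : phi s = phi s + a *: 0 by rewrite scaler0 addr0.
rewrite [X in _ --> X]lim_s.
under eq_fun do rewrite linearD linearZ.
exact: cvgD (cvg_cst _) (@cvgZl_tmp _ R^o _ _ _ a _ 0 px).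
Qed.

Lemma weak_cvg_sub (V : normedModType R) (u : nat -> V) (l : V) :
  weak_cvg u l -> weak_cvg (fun n => u n - l) 0.
Proof.
move=> ul phi phic.
rewrite linear0 -[X in _ --> X](subrr (phi l)).
under eq_fun do rewrite linearB.
exact: cvgB (ul phi phic) (cvg_cst _).
Qed.

Variables (X Y : normedModType R) (p K : R).
Hypotheses (p1 : 1 <= p) (K0 : 0 < K).
Hypothesis auc : forall t : R, 0 <= t <= 1 ->
  ((K * t `^ p)%:E <= auc_modulus Y t)%E.
Variables (f : X -> Y) (alpha th : R).
Hypotheses (fw : weakly_seq_continuous f) (alpha0 : 0 < alpha) (th0 : 0 < th).
Hypothesis f_sep : forall u v, `|u - v| = alpha -> th <= `|f u - f v|.

Lemma exists_sum_lower_bound (x : nat -> X) (N l : nat) :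
  (forall n, `|x n| = 1) -> weak_cvg x 0 ->
  exists n : nat -> nat,
    [/\ forall i, (l <= n i)%N,
        forall i j, (i < j < N)%N -> (n i < n j)%N,
        (0 < N)%N -> th <= `|f (alpha *: \sum_(i < N) x (n i)) - f 0| &
        Num.min 1 (K / 2) * th `^ p * N%:R <=
          `|f (alpha *: \sum_(i < N) x (n i)) - f 0| `^ p].
Proof.
move=> x1 x0; elim: N => [|N [n [nl n_incr n_th n_pow]]].
  by exists (fun=> l); split=> //; [move=> i j; rewrite andbF|
    rewrite mulr0 powR_ge0].
set s := alpha *: _ in n_th n_pow; set kap := Num.min 1 (K / 2) in n_pow *.
have thp0 : 0 <= th `^ p by exact: powR_ge0.
have step m : th <= `|f (s + alpha *: x m) - f s|.
  by apply: f_sep; rewrite [s + _]addrC addrK normrZ x1 mulr1 gtr0_norm.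
have [m [lm nm th_m pow_m]] : exists m, [/\ (l <= m)%N,
    forall i, (i < N)%N -> (n i < m)%N,
    th <= `|f (s + alpha *: x m) - f 0| &
    kap * th `^ p * N.+1%:R <= `|f (s + alpha *: x m) - f 0| `^ p].
  (* At the first step the base vector [f s - f 0] vanishes, so only the separation [th] is
     available; this is why [kap] is capped by 1. *)
  have [N0|N0] := posnP N.
    have s0 : s = 0 by rewrite /s N0 big_ord0 scaler0.
    have := step l; rewrite s0 => thl.
    exists l; split=> // [i|]; first by rewrite N0.
    rewrite N0 mulr1; apply: le_trans (_ : th `^ p <= _).
      by rewrite ler_piMl// /kap ge_min lexx.
    by rewrite ge0_ler_powR ?nnegrE ?(ltW th0) ?(le_trans ler01 p1).
  have y0 : weak_cvg (fun m => f (s + alpha *: x m) - f s) 0.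
    by apply: weak_cvg_sub; apply: fw; exact: weak_cvg_affine.
  have big := nbhs_infty_ge (maxn l (\max_(i < N) n i).+1).
  have low := auc_weakly_null_powR p1 K0 auc th0 (n_th N0) step y0.
  have [m [/= mbig]] := filter_ex (filterI big low).
  rewrite [f s - _ + _]addrC addrA subrK => -[r_m pow_m].
  move: mbig; rewrite geq_max => /andP[lm nm].
  exists m; split=> //.
  - move=> i iN; apply: leq_trans nm; rewrite ltnS.
    exact: (leq_bigmax (Ordinal iN)).
  - exact: le_trans (n_th N0) r_m.
  - apply: le_trans pow_m; rewrite -natr1 mulrDr mulr1 lerD//.
    by rewrite ler_wpM2r// /kap ge_min lexx orbT.
(* The default [m] keeps all indices, also those beyond [N], at least [l]. *)
pose n' i := if (i < N)%N then n i else m.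
have sum_n' : alpha *: \sum_(i < N.+1) x (n' i) = s + alpha *: x m.
  rewrite big_ord_recr/= /n' ltnn scalerDr; congr (_ *: _ + _).
  by apply: eq_bigr => i _; rewrite ltn_ord.
exists n'; rewrite sum_n'; split=> //.
- by move=> i; rewrite /n'; case: ifP.
- move=> i j /andP[ij]; rewrite ltnS leq_eqVlt /n' => /predU1P[jN|jN].
    by rewrite -jN ij jN ltnn; apply: nm; rewrite -jN.
  by rewrite jN (ltn_trans ij jN); apply: n_incr; rewrite ij.
Qed.

End lower_bound_on_sums.

(** * Quantitative consequences of coarseness and of Property [( * )] *)

Section coarse_maps.
Set Implicit Arguments.
Unset Strict Implicit.
Variables (R : realType) (X Y : normedModType R) (f : X -> Y).

(** The segment from 0 to [x] is walked in steps of length at most 1, each moving the image by at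
    most [L]. *)
Lemma coarse_affine_bound : coarse f ->
  exists2 L : R, 0 < L & forall x, `|f x - f 0| <= L * (`|x| + 1).
Proof.
move=> /(_ 1 ler01) f1.
have [L L0 fL] : exists2 L : R, 0 < L &
    forall u v, `|u - v| <= 1 -> `|f u - f v| <= L.
  have ub u v : `|u - v| <= 1 -> (`|f u - f v|%:E <= expansion_modulus f 1)%E.
    by move=> uv; apply: ereal_sup_ubound; exists (u, v).
  case: (expansion_modulus f 1) f1 ub => [r _ ub|//|_ ub].
    exists (`|r| + 1); first by rewrite ltr_wpDl.
    move=> u v /ub; rewrite lee_fin => /le_trans; apply.
    by rewrite (le_trans (ler_norm _))// lerDl.
  by have := ub 0 0; rewrite subrr normr0 => /(_ ler01).
exists L => // x.
have steps N z : `|z| <= N%:R -> `|f z - f 0| <= L * N%:R.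
  elim: N z => [|N IH] z zN.
    by move: zN; rewrite normr_le0 => /eqP ->; rewrite subrr normr0 mulr0.
  pose w := (N%:R / N.+1%:R : R) *: z.
  have wN : `|w| <= N%:R.
    rewrite normrZ ger0_norm ?divr_ge0// mulrAC ler_pdivrMr ?ltr0Sn//.
    by rewrite ler_wpM2l.
  have zw : `|z - w| <= 1.
    have -> : z - w = (N.+1%:R^-1 : R) *: z.
      rewrite /w -[X in X - _]scale1r -scalerBl; congr (_ *: _).
      have N0 : N.+1%:R != 0 :> R by rewrite pnatr_eq0.
      by apply: (mulIf N0); rewrite mulrBl mul1r divfK// mulVf// -natr1 addrC addKr.
    by rewrite normrZ gtr0_norm ?invr_gt0 ?ltr0Sn// ler_pdivrMl ?ltr0Sn// mulr1.
  rewrite -natr1 mulrDr mulr1 [X in _ <= X]addrC.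
  by apply: le_trans (ler_distD (f w) _ _) (lerD (fL _ _ zw) (IH _ wN)).
apply: le_trans (steps (Num.truncn `|x|).+1 x _) _.
  exact: ltW (truncnS_gt _).
by rewrite ler_pM2l// -natr1 lerD2r truncn_le.
Qed.

Lemma property_star_separation : property_star f ->
  exists alpha th : R, [/\ 0 < alpha, 0 < th &
    forall u v, `|u - v| = alpha -> th <= `|f u - f v|].
Proof.
move=> [alpha [beta [alpha0 ab I0]]]; move: I0.
set I := ereal_inf _ => I0.
have lb u v : `|u - v| = alpha -> (I <= `|f u - f v|%:E)%E.
  move=> uv; apply: ereal_inf_lbound; exists (u, v) => //=.
  by rewrite uv lexx ltW.
(* A finite infimum serves as [th]. If it is +oo, no pair is at distance [alpha], and 1 will do. *)
case: I I0 lb => [r|?|]; last by rewrite ltNge leNye.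
  by move=> r0 lb; exists alpha, r; split=> // u v /lb.
by move=> lb; exists alpha, 1; split=> // u v /lb.
Qed.

End coarse_maps.

(** * Cutting into blocks and comparing the two bounds *)

Lemma norm_sum_blocks (R : realType) (V : normedModType R) (z : nat -> V)
    (k m : nat) (B : R) :
  (forall j, (j < m)%N -> `|\sum_(i < k) z (j * k + i)%N| <= B) ->
  `|\sum_(i < m * k) z i| <= m%:R * B.
Proof.
elim: m => [|m IH] zB; first by rewrite mul0n big_ord0 normr0 mul0r.
rewrite mulSnr big_split_ord/= -natr1 mulrDl mul1r.
apply: le_trans (ler_normD _ _) (lerD _ (zB _ _)) => //.
by apply: IH => j jm; apply: zB; exact: ltnW.
Qed.

Theorem corollary1p4 (R : realType) (X Y : completeNormedModType R) (p : R) :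
  (exists f : X -> Y,
     [/\ weakly_seq_continuous f, coarse f & property_star f]) ->
  1 <= p ->
  p_AUC Y p ->
  co_Banach_Saks X p.
Proof.
move=> [f [fw /coarse_affine_bound[L L0 fL]]].
move=> /property_star_separation[alpha [th [alpha0 th0 f_sep]]] p1 [K K0 auc].
have p0 : 0 < p by lra.
have powK a : 0 <= a -> (a `^ p) `^ p^-1 = a.
  by move=> a0; rewrite -powRrM divff ?gt_eqF// powRr1.
pose kap := Num.min 1 (K / 2); pose A := kap * th `^ p.
have A0 : 0 < A by rewrite mulr_gt0 ?powR_gt0// lt_min ltr01 divr_gt0.
pose c0 := A `^ p^-1; have c00 : 0 < c0 by rewrite powR_gt0.
(* The number of blocks is chosen, independently of [k], so that [4 * L <= q]. *)
pose m := (Num.truncn ((4 * L / c0) `^ p)).+1.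
have m0 : 0 < m%:R :> R by rewrite ltr0Sn.
have Lc0 : 0 <= 4 * L / c0 by rewrite divr_ge0 ?mulr_ge0 ?ltW.
pose q := c0 * m%:R `^ p^-1.
have q4L : 4 * L <= q.
  rewrite /q [c0 * _]mulrC -ler_pdivrMr// -(powK _ Lc0).
  rewrite ge0_ler_powR ?invr_ge0 ?nnegrE ?powR_ge0 ?(ltW p0) ?(ltW m0)//.
  exact/ltW/truncnS_gt.
have q0 : 0 < q by apply: lt_le_trans (mulr_gt0 (ltr0Sn _ _) L0) q4L.
have D0 : 0 < 2 * L * (alpha * m%:R) by rewrite mulr_gt0// mulr_gt0.
exists (q / (2 * L * (alpha * m%:R))); first exact: divr_gt0.
move=> S x e x1 x0 [_ _ spread] k.
have [->|k0] := posnP k; first by rewrite powR0 ?mulr0// invr_eq0 gt_eqF.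
set M := `|_|.
(* With this tolerance the errors of the [m] blocks, scaled by [alpha], add up to 1; with the 1 of
   the affine bound this gives the 2 in [F_le]. *)
have eps0 : 0 < (alpha * m%:R)^-1 by rewrite invr_gt0 mulr_gt0.
have [l le_l] := spread _ k eps0.
have [n [nl n_incr _ n_pow]] :=
  exists_sum_lower_bound p1 K0 auc fw alpha0 th0 f_sep (m * k) l x1 x0.
set F := `|_| in n_pow.
have F_ge : q * k%:R `^ p^-1 <= F.
  rewrite /q -mulrA -powRM// -natrM /c0 -powRM ?(ltW A0)//.
  have An0 : 0 <= A * (m * k)%:R by exact: mulr_ge0 (ltW A0) (ler0n _ _).
  have F0 : 0 <= F by exact: normr_ge0.
  rewrite -[F](powK _ F0).
  by rewrite ge0_ler_powR ?invr_ge0 ?nnegrE ?powR_ge0 ?(ltW p0).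
have sum_le : `|\sum_(i < m * k) x (n i)| <= m%:R * (M + (alpha * m%:R)^-1).
  apply: (@norm_sum_blocks _ _ (x \o n)) => j jm /=.
  have sum1 (W : normedModType R) (z : 'I_k -> W) :
      \sum_(i < k) 1 *: z i = \sum_(i < k) z i.
    by under eq_bigr do rewrite scale1r.
  have := le_l (fun i : 'I_k => n (j * k + i)%N) (fun=> 1).
  rewrite !sum1 -/M => h; rewrite -lerBlDl.
  apply: le_trans (ler_norm _) (h _ _ _) => //.
  - move=> i i' ii'; apply: n_incr; rewrite ltn_add2l ii'/=.
    apply: leq_trans (_ : j.+1 * k <= _)%N; last by rewrite leq_mul2r jm orbT.
    by rewrite mulSnr ltn_add2l.
  - by move=> _; rewrite lexx andbT (le_trans (lerN10 R) ler01).
have F_le : F <= L * (alpha * m%:R * M + 2).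
  apply: le_trans (fL _) _; rewrite ler_pM2l//.
  rewrite normrZ (gtr0_norm alpha0).
  have := ler_wpM2l (ltW alpha0) sum_le.
  rewrite mulrA mulrDr divff ?gt_eqF ?mulr_gt0//; lra.
have k1 : 1 `^ p^-1 <= k%:R `^ p^-1 :> R.
  by rewrite ge0_ler_powR ?invr_ge0 ?nnegrE ?(ltW p0) ?ler1n.
rewrite powR1 in k1.
rewrite mulrAC ler_pdivrMr//.
have Fk := le_trans F_ge F_le.
(* Hence the additive term [2 * L] is at most half of the lower bound in [F_ge], which explains the
   2 in the denominator of the constant. *)
have : q <= q * k%:R `^ p^-1 by rewrite ler_peMr// ltW.
lra.
Qed.
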